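(* For every integer $k\ge 3$ there exists a $2$-edge-connected plane graph $G$ with exactly $4k$ vertices such that $\chi_{fp}(G)=12$.
   Context: All graphs are finite, planar, with a fixed plane embedding. A vertex-coloring of $G$ is a map $V(G)\to\mathbb{N}$. A facial-parity vertex-coloring of a plane graph $G$ is a facially-proper vertex-coloring (any two vertices appearing consecutively on the boundary of a face, i.e. adjacent vertices, receive distinct colors) such that for every face $\alpha$ and every color $c$, the number of vertices incident with $\alpha$ having color $c$ is either zero or odd. $\chi_{fp}(G)$ denotes the minimum number of colors in a facial-parity vertex-coloring of $G$. *)

(* Defs.v *)
From HB Require Import structures.
From mathcomp Require Import all_boot all_order all_algebra.
From mathcomp Require Import all_classical all_reals all_analysis.

Set Implicit Arguments.
Unset Strict Implicit.
Unset Printing Implicit Defensive.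

Import Order.TTheory GRing.Theory Num.Theory.
Import numFieldNormedType.Exports.

Local Open Scope classical_set_scope.
Local Open Scope ring_scope.

Definition is_arc (R : realType) (A : set (R * R)) (a b : R * R) : Prop :=
  exists g : R -> R * R,
    [/\ {within `[0, 1], continuous g},
        {in `[0, 1] &, injective g},
        g 0 = a, g 1 = b & A = g @` `[0, 1]].

(* A finite simple graph drawn in the plane [R * R]: edges are arcs between
   the points of their ends, and the interior of an edge contains no vertex
   and no point of another edge. The value of [arc x y] is only meaningful
   when [adj x y]. *)
Record plane_graph (R : realType) := PlaneGraph {
  vertex : finType;
  adj : rel vertex;
  pos : vertex -> R * R;
  arc : vertex -> vertex -> set (R * R);
  adj_sym : symmetric adj;
  adj_irr : irreflexive adj;
  pos_inj : injective pos;
  arc_sym : forall x y, adj x y -> arc x y = arc y x;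
  arcP : forall x y, adj x y -> is_arc (arc x y) (pos x) (pos y);
  arc_vertex : forall x y z, adj x y -> arc x y (pos z) -> z = x \/ z = y;
  arc_cross : forall x y x' y', adj x y -> adj x' y' ->
    ~ (x = x' /\ y = y') -> ~ (x = y' /\ y = x') ->
    arc x y `&` arc x' y' `<=` range pos }.

Section PlaneGraph.
Variables (R : realType) (G : plane_graph R).
Local Notation V := (vertex G).

Definition graph_connected (T : finType) (e : rel T) : Prop :=
  forall x y, connect e x y.

Definition del_edge (T : finType) (e : rel T) (u v : T) : rel T :=
  [rel x y | [&& e x y, (x, y) != (u, v) & (x, y) != (v, u)]].

Definition two_edge_connected : Prop :=
  [/\ (1 < #|V|)%N,
      graph_connected (@adj R G)
    & forall u v : V, adj u v -> graph_connected (del_edge (@adj R G) u v)].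

Definition drawing : set (R * R) :=
  range (@pos R G) `|` [set p | exists x y : V, adj x y /\ arc x y p].

Definition is_face (F : set (R * R)) : Prop :=
  exists2 p, (~` drawing) p & F = connected_component (~` drawing) p.

(* A face contains no vertex, so for vertices lying in its closure and lying
   on its boundary are the same. *)
Definition incident (v : V) (F : set (R * R)) : Prop := closure F (pos v).

Definition face_color_count (col : V -> nat) (F : set (R * R)) (c : nat) : nat :=
  #|[pred v : V | `[< incident v F >] && (col v == c)]|.

Definition facial_parity_coloring (col : V -> nat) : Prop :=
  (forall x y : V, adj x y -> col x <> col y) /\
  (forall (F : set (R * R)) (c : nat), is_face F ->
     face_color_count col F c = 0%N \/ odd (face_color_count col F c)).

Definition num_colors (col : V -> nat) : nat := size (undup (codom col)).

Definition facial_parity_colors (n : nat) : Prop :=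
  exists2 col : V -> nat, facial_parity_coloring col & num_colors col = n.

(* Giving all vertices distinct colors is always admissible. *)
Lemma facial_parity_colors_ex : exists n, `[< facial_parity_colors n >].
Proof.
pose col (v : V) : nat := enum_rank v.
have col_inj : injective col by move=> x y /ord_inj /enum_rank_inj.
exists (num_colors col); apply/asboolP; exists col => //; split.
  by move=> x y xy /col_inj exy; move: xy; rewrite exy adj_irr.
move=> F c _; have : (face_color_count col F c <= 1)%N.
  apply/card_le1_eqP => x y; rewrite !inE => /andP[_ /eqP xc] /andP[_ /eqP yc].
  by apply: col_inj; rewrite xc yc.
by case: face_color_count => [|[|]//]; [left|right].
Qed.

Definition chi_fp : nat := ex_minn facial_parity_colors_ex.

End PlaneGraph.

(* Main.v *)
Require Import Defs.
From mathcomp Require Import all_boot all_order all_algebra zify lra.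
From mathcomp Require Import all_classical all_reals all_analysis.

(* Take three paths of four vertices on three rays from the origin and join
   their inner ends, and their outer ends, by a triangle. The three sectors
   between consecutive paths are faces, so for each colour the numbers n0, n1,
   n2 of its occurrences on the paths satisfy: n0+n1, n1+n2 and n2+n0 are zero
   or odd. Three odd numbers cannot sum to 2(n0+n1+n2), hence only one n_i is
   nonzero and it is odd; a path on four vertices has no three pairwise
   nonadjacent vertices, so the colour occurs once and the twelve vertices have
   distinct colours. Now surround this by k-3 concentric rings of four vertices.
   A face cannot cross a ring, and two disjoint sets of four colours, avoiding
   those of the outer triangle, colour the rings alternately. *)

Set Implicit Arguments.
Unset Strict Implicit.
Unset Printing Implicit Defensive.

Import Order.TTheory GRing.Theory Num.Theory.
Import numFieldNormedType.Exports.

Local Open Scope classical_set_scope.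
Local Open Scope ring_scope.

(** * Connectivity along cycles *)

Section Cycles.
Variables (T : finType) (e : rel T) (u v : T).
Hypothesis e_sym : symmetric e.

Lemma del_edge_sym : connect_sym (del_edge e u v).
Proof.
apply: sym_connect_sym => x y; rewrite /del_edge /= [e x y]e_sym; congr (_ && _).
by rewrite !xpair_eqE andbC; congr (~~ _ && ~~ _); rewrite andbC.
Qed.

Lemma path_connect_in (d : rel T) x q : connect_sym d -> path d x q ->
  {in x :: q &, forall y z, connect d y z}.
Proof.
move=> d_sym pq y z /(path_connect pq) xy /(path_connect pq) xz.
by apply: connect_trans xz; rewrite d_sym.
Qed.

(* If the deleted edge lies on the cycle, rotate it to the closing position. *)
Lemma cycle_del_edge_connect (p : seq T) : ucycle e p -> (2 < size p)%N ->
  {in p &, forall x y, connect (del_edge e u v) x y}.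
Proof.
set d := del_edge e u v => /andP[cp up] sp.
have [cdp|ncd] := boolP (cycle d p).
  case: p cp up sp cdp => [//|x q] cp up sp.
  rewrite /= rcons_path => /andP[pq _].
  exact: (path_connect_in del_edge_sym pq).
(* Since [p] is not a cycle for [d], some [x] and its successor are the two ends of the deleted
   edge. *)
have [x xp nd] : exists2 x, x \in p & ~~ d x (next p x).
  apply/hasP; apply: contraR ncd => /hasPn h.
  by apply: (cycle_from_next up) => x xp; move: (h x xp); rewrite negbK.
have exn := next_cycle cp xp.
have xy : x = prev p (next p x) by rewrite prev_next.
have yp : next p x \in p by rewrite mem_next.
move: {xp} (next p x) nd exn xy yp => y nd exn xy yp.
have [i q Eq] := rot_to yp.
have cq : cycle e (y :: q) by rewrite -Eq rot_cycle.
have uq : uniq (y :: q) by rewrite -Eq rot_uniq.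
have sq : (1 < size q)%N by rewrite -ltnS -(size_rot i) Eq in sp.
have xl : x = last y q.
  rewrite xy -(prev_rot i up) Eq prev_nth mem_head -nth_last.
  have yq : y \notin q by case/andP: uq.
  by rewrite memNindex //; case: q sq {Eq cq uq yq}.
(* The rotated cycle starts at [y] and ends at [x]. Its first step leads to [b], which differs from
   [x] because the cycle has more than two vertices; all later steps avoid [y]. So no step uses the
   deleted edge. *)
have pq : path d y q.
  have [yq {}uq] := andP uq.
  have := cq; rewrite /= rcons_path => /andP[peq _].
  case: q {Eq cq} sq xl yq uq peq => [//|b [//|c q]] _ xl yq uq.
  move=> /andP[eyb pq].
  have yb : y != b by apply: contra yq => /eqP <-; rewrite mem_head.
  have xb : x != b.
    rewrite xl /=; case/andP: uq => + _; apply: contra => /eqP <-.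
    exact: mem_last.
  move: nd; rewrite /d /del_edge /= exn /= negb_and !negbK => nd.
  have dz z t : e z t -> ((z == y) ==> (t != x)) && ((t == y) ==> (z != x)) ->
      d z t.
    rewrite /d /del_edge /= => -> /= h; rewrite !xpair_eqE.
    move: nd; rewrite !xpair_eqE => /orP[]/andP[/eqP <- /eqP <-].
      by move: h; case: (z == x); case: (t == y); case: (z == y); case: (t == x).
    by move: h; case: (z == x); case: (t == y); case: (z == y); case: (t == x).
  apply/andP; split.
    by apply: dz => //; rewrite eqxx eq_sym xb eq_sym (negPf yb).
  have ed : {in [pred z | z != y] &, subrel e d}.
    move=> z t; rewrite !inE => /negPf zy /negPf ty ezt.
    by apply: dz => //; rewrite zy ty.
  have Pq : all [pred z | z != y] (b :: c :: q).
    by apply/allP => z zq; rewrite inE; apply: contraNneq yq => <-.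
  exact: (sub_in_path ed Pq pq).
move=> z t zp tp; apply: (path_connect_in del_edge_sym pq).
  by rewrite -Eq mem_rot.
by rewrite -Eq mem_rot.
Qed.
End Cycles.

(** * The graph *)

Section Web.
Variable k : nat.
Local Open Scope nat_scope.

Definition web_vertex := ('I_k * 'I_4)%type.
Implicit Types u v w : web_vertex.

(* Blocks 0, 1, 2 are the paths, on the rays 0, 1, 2 at radii 1 to 4; block
   [b >= 3] is the ring of radius [b + 2]. *)
Definition ray v : nat := if v.1 < 3 then v.1 : nat else v.2 : nat.
Definition rad v : nat := if v.1 < 3 then v.2.+1 else v.1.+2.

Definition polar v := (ray v, rad v).

(** Ray 3 carries no radial edge: a vertex on it only subdivides one side of its ring, giving the
    ring its fourth vertex. *)
Definition radial (x y : nat * nat) :=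
  [&& x.1 == y.1, x.1 < 3 & y.2 == x.2.+1].
(** Triangles at radii 1 and 4, quadrilaterals from radius 5 on. Each side is listed in one
    direction only; [polar_adj] symmetrises. *)
Definition side r i j :=
  if r < 5 then
    ((r == 1) || (r == 4)) && ((i, j) \in [:: (0, 1); (1, 2); (2, 0)])
  else (i, j) \in [:: (0, 1); (1, 2); (2, 3); (3, 0)].
Definition ring (x y : nat * nat) := (x.2 == y.2) && side x.2 x.1 y.1.
Definition edge x y := radial x y || ring x y.
Definition polar_adj x y := edge x y || edge y x.
Definition web_adj u v := polar_adj (polar u) (polar v).

Variant polar_spec : nat -> nat -> Prop :=
  | PolarPath i r of i < 3 & 0 < r < 5 : polar_spec i r
  | PolarRing i r of i < 4 & 4 < r <= k.+1 : polar_spec i r.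

Lemma polarP v : polar_spec (ray v) (rad v).
Proof.
rewrite /ray /rad; have := ltn_ord v.1; have := ltn_ord v.2.
by case: ifPn => v1 v2 v3; constructor; lia.
Qed.

Lemma polar_inj u v : ray u = ray v -> rad u = rad v -> u = v.
Proof.
case: u v => [b j] [b' j']; rewrite /ray /rad /=; have := ltn_ord j; have := ltn_ord j'.
do 2 case: ifPn => ?; move=> ? ? ? ?.
- by congr pair; apply: val_inj => /=; lia.
- lia.
- lia.
- by congr pair; apply: val_inj => /=; lia.
Qed.

Lemma web_adj_sym : symmetric web_adj.
Proof. by move=> u v; rewrite /web_adj /polar_adj orbC. Qed.

Lemma web_adj_irr : irreflexive web_adj.
Proof.
move=> u; rewrite /web_adj /polar_adj orbb /edge /radial /ring /side.
by rewrite !inE !xpair_eqE; case: ifP => _; lia.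
Qed.

Lemma card_web_vertex : #|{: web_vertex}| = 4 * k.
Proof. by rewrite card_prod !card_ord mulnC. Qed.

Hypothesis hk : 3 <= k.

Lemma polar_surj i r : polar_spec i r -> exists v, ray v = i /\ rad v = r.
Proof.
case=> {}i {}r hi hr.
  have h1 : i < k by lia. have h2 : r.-1 < 4 by lia.
  exists (Ordinal h1, Ordinal h2); rewrite /ray /rad /= hi; split => //; lia.
have h1 : r.-2 < k by lia.
have h3 : (r.-2 < 3) = false by lia.
by exists (Ordinal h1, Ordinal hi); rewrite /ray /rad /= h3; split => //; lia.
Qed.

(** * Two-edge-connectivity *)

Section TwoEdge.
Variables a b : web_vertex.
Local Notation d := (del_edge web_adj a b).

(** Allows cycles to be written as lists of numeric pairs, which lift to vertices by [polar_surj]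
    and [polar_inj]. *)
Lemma polar_cycle_connect s u v : {in s, forall x, polar_spec x.1 x.2} ->
  ucycle polar_adj s -> 2 < size s -> polar u \in s -> polar v \in s ->
  connect d u v.
Proof.
move=> sP /andP[cs us] ss us' vs'.
have [p Ep] : exists p, s = map polar p.
  elim: s sP {cs us ss us' vs'} => [|x s IH] sP; first by exists [::].
  have [y [y1 y2]] := polar_surj (sP x (mem_head _ _)).
  have [p ->] : exists p, s = map polar p.
    by apply: IH => z zs; apply: sP; rewrite inE zs orbT.
  by exists (y :: p); rewrite /= /polar y1 y2 -surjective_pairing.
have polarI : injective polar by move=> x y [] /polar_inj h /h.
move: us' vs'; rewrite Ep !(mem_map polarI) => up vp.
apply: (cycle_del_edge_connect (p := p) _ _ web_adj_sym) => //.
  apply/andP; split; last by move: us; rewrite Ep (map_inj_uniq polarI).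
  by move: cs; rewrite Ep cycle_map.
by rewrite Ep size_map in ss.
Qed.

(** Overlapping cycles cover the graph, and each stays connected without the deleted edge. Two
    cycles handle the paths, then one cycle per ring works outwards. *)
Lemma del_edge_connected : graph_connected d.
Proof.
have base u v : rad u < 5 -> rad v < 5 -> connect d u v.
  (* The boundaries of two sectors; both contain the path on ray 1, and together they cover all
     three paths. *)
  pose s1 := [:: (0,1); (0,2); (0,3); (0,4); (1,4); (1,3); (1,2); (1,1)].
  pose s2 := [:: (1,1); (1,2); (1,3); (1,4); (2,4); (2,3); (2,2); (2,1)].
  have sP s : all (fun x => (x.1 < 3) && (0 < x.2 < 5)) s ->
      {in s, forall x, polar_spec x.1 x.2}.
    by move=> /allP h x /h /andP[? ?]; constructor.
  have [w [w1 w2]] : exists w, ray w = 1 /\ rad w = 1.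
    by apply: polar_surj; constructor.
  suff h x : rad x < 5 -> connect d w x.
    move=> hu hv; apply: connect_trans (h v hv).
    by rewrite (del_edge_sym _ _ web_adj_sym) h.
  move=> hx.
  have : polar x \in s1 ++ s2.
    rewrite /polar; case: (polarP x) hx => i r; last lia.
    by do 3?[case: i => [|i] //]; do 5?[case: r => [|r] //].
  rewrite mem_cat => /orP[] hs.
    by apply: (@polar_cycle_connect s1) => //; [exact: sP | rewrite /polar w1 w2].
  by apply: (@polar_cycle_connect s2) => //; [exact: sP | rewrite /polar w1 w2].
have [w [w1 w2]] : exists w, ray w = 0 /\ rad w = 4.
  by apply: polar_surj; constructor.
suff h n x : rad x <= n.+4 -> connect d w x.
  move=> x y; apply: connect_trans (h (rad y) y _); last lia.
  by rewrite (del_edge_sym _ _ web_adj_sym) (h (rad x)) //; lia.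
elim: n x => [|n IH] x hx; first by apply: base; lia.
have [/IH//|hn] := leqP (rad x) n.+4.
have {hn}hx : rad x = n.+1.+4 by lia.
have [y [y1 y2]] : exists y, ray y = 0 /\ rad y = n.+4.
  by apply: polar_surj; case: n {IH} hx => [|n] hx; constructor => //;
    case: (polarP x) hx => i r; lia.
apply: (connect_trans (IH y _)); first by rewrite y2.
pose r := n.+4; pose q := n.+1.+4.
have hq : q <= k.+1 by rewrite /q -hx; case: (polarP x) => *; lia.
(* This six-cycle contains all four vertices of the ring of radius [q] and the vertex [y] of radius
   [r], already reached by induction. *)
apply: (@polar_cycle_connect
  [:: (0, r); (1, r); (1, q); (2, q); (3, q); (0, q)]) => //.
- move=> z; rewrite !inE.
  have hr : polar_spec 0 r /\ polar_spec 1 r.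
    by rewrite /r; case: n @r @q IH hx y2 hq => [|n] *; split; constructor; lia.
  by do !case/orP; move=> /eqP -> /=; (try by case: hr); apply: PolarRing; lia.
- rewrite /ucycle /= {hq}/q /r {q r}; case: n {IH hx y2} => [//|n].
  rewrite /polar_adj /edge /radial /ring /side /= !inE !xpair_eqE /= !eqxx /=.
  lia.
- by rewrite /polar y1 y2 mem_head.
- rewrite /polar hx; have : ray x < 4 by case: (polarP x) => *; lia.
  by case: (ray x) => [|[|[|[|i]]]] // _; rewrite !inE !xpair_eqE !eqxx ?orbT.
Qed.

End TwoEdge.

Lemma web_connected : graph_connected web_adj.
Proof.
move=> x y; have := @del_edge_connected x x x y; apply: connect_sub.
by move=> u v /and3P[uv _ _]; exact: connect1.
Qed.

End Web.

(** * Segments and the triangular gauge *)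

Section Segments.
Variable R : realType.
Implicit Types a b p : R * R.

Definition line a b (t : R) : R * R :=
  ((1 - t) * a.1 + t * b.1, (1 - t) * a.2 + t * b.2).

Definition segment a b : set (R * R) :=
  [set p | exists2 t, 0 <= t <= 1 & p = line a b t].

Lemma line0 a b : line a b 0 = a.
Proof. by rewrite /line subr0 !mul1r !mul0r !addr0 -surjective_pairing. Qed.

Lemma line1 a b : line a b 1 = b.
Proof. by rewrite /line subrr !mul1r !mul0r !add0r -surjective_pairing. Qed.

Lemma line_continuous a b : continuous (line a b).
Proof.
have affine x y : continuous (fun t : R => (1 - t) * x + t * y).
  move=> t; apply: cvgD; apply: cvgMl; last exact: cvg_id.
  by apply: cvgB; [exact: cvg_cst|exact: cvg_id].
by move=> t; exact: (cvg_pair (@affine a.1 b.1 t) (@affine a.2 b.2 t)).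
Qed.

Lemma segmentC a b : segment a b = segment b a.
Proof.
suff sub a' b' : segment a' b' `<=` segment b' a' by rewrite eqEsubset.
move=> p [t /andP[t0 t1] ->]; exists (1 - t); first by apply/andP; split; lra.
by rewrite /line subKr; congr pair; exact: addrC.
Qed.

Lemma segment_image a b : segment a b = line a b @` `[0, 1].
Proof.
rewrite eqEsubset; split=> p [t ht].
  by move=> ->; exists t => //=; rewrite in_itv.
by move=> <-; exists t => //; move: ht; rewrite /= in_itv.
Qed.

Lemma segment_arc a b : a != b -> is_arc (segment a b) a b.
Proof.
move=> ab; exists (line a b); split.
- by apply: continuous_subspaceT => t; exact: line_continuous.
- move=> s t _ _ [] h1 h2; apply: contraNeq ab => st.
  have h1' : (s - t) * (b.1 - a.1) = 0 by lra.
  have h2' : (s - t) * (b.2 - a.2) = 0 by lra.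
  move: h1' h2' => /eqP + /eqP; rewrite !mulf_eq0 subr_eq0 (negPf st) /=.
  rewrite !subr_eq0 => /eqP e1 /eqP e2.
  by rewrite (surjective_pairing a) (surjective_pairing b) e1 e2.
- exact: line0.
- exact: line1.
- exact: segment_image.
Qed.

Lemma connected_segment a b : connected (segment a b).
Proof.
rewrite segment_image; apply: connected_continuous_connected.
  exact: segment_connected.
by apply: continuous_subspaceT => t; exact: line_continuous.
Qed.
End Segments.

Section Gauge.
Variable R : realType.
Implicit Types (p : R * R) (s t : R).

(* The gauge of the triangle with corners [(1,0)], [(0,1)] and [(-1,-1)]. *)
Definition gauge p : R :=
  Num.max (p.1 + p.2) (Num.max (p.2 - 2 * p.1) (p.1 - 2 * p.2)).

(* Directions of the four rays; ray 3 bisects the side from ray 2 to ray 0. *)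
Definition dx (i : nat) : R := nth 0 [:: 1; 0; -1; 0] i.
Definition dy (i : nat) : R := nth 0 [:: 0; 1; -1; - 2^-1] i.

(* The point with coordinates [s] and [t] along the rays [i] and [j]. *)
Definition mix i s j t : R * R := (s * dx i + t * dx j, s * dy i + t * dy j).

Lemma gaugeE p r : p.1 + p.2 <= r -> p.2 - 2 * p.1 <= r -> p.1 - 2 * p.2 <= r ->
  [\/ p.1 + p.2 = r, p.2 - 2 * p.1 = r | p.1 - 2 * p.2 = r] -> gauge p = r.
Proof.
move=> h1 h2 h3 h; apply/le_anti; rewrite /gauge !ge_max h1 h2 h3 /= !le_max.
by case: h => ->; rewrite lexx ?orbT.
Qed.

(** On the cone spanned by two joined rays the gauge is linear, with value 1 on both directions.
    Hence every ring lies on a level set. *)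
Lemma gauge_side r i j s t : side r i j -> 0 <= s -> 0 <= t ->
  gauge (mix i s j t) = s + t.
Proof.
move=> + s0 t0; rewrite /side.
have h : (i, j) \in [:: (0, 1); (1, 2); (2, 3); (3, 0); (2, 0)]%N ->
    gauge (mix i s j t) = s + t.
  rewrite !inE; do !case/orP; move=> /eqP[-> ->]; rewrite /mix /dx /dy /=;
    apply: gaugeE => /=; rewrite ?[X in X <= _]/=; try lra;
    (do [by constructor 1; lra | by constructor 2; lra | by constructor 3; lra]).
case: ifP => _; first move=> /andP[_]; rewrite !inE => {}h'; apply: h;
  rewrite !inE; move: h'; by do !case/orP; move=> ->; rewrite ?orbT.
Qed.

Lemma gauge_ray i s : (i < 4)%N -> 0 <= s -> gauge (s * dx i, s * dy i) = s.
Proof.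
move=> hi s0; have [j ij] : exists j, side 5 i j.
  by case: i hi => [|[|[|[|]]]] // _; [exists 1%N|exists 2%N|exists 3%N|exists 0%N].
by have := gauge_side ij s0 (lexx 0); rewrite /mix !mul0r !addr0.
Qed.

Lemma ray_disjoint i j s t : (i < 4)%N -> (j < 4)%N -> 0 < s -> 0 < t ->
  s * dx i = t * dx j -> s * dy i = t * dy j -> i = j.
Proof.
rewrite /dx /dy.
by case: i => [|[|[|[|]]]] //; case: j => [|[|[|[|]]]] // => _ _ s0 t0 /= h1 h2;
  exfalso; lra.
Qed.
End Gauge.

(** * The drawing *)

Section Drawing.
Variables (R : realType) (k : nat).
Implicit Types (u v z : web_vertex k) (p : R * R) (s t : R).

Definition web_pos v : R * R :=
  ((rad v)%:R * dx R (ray v), (rad v)%:R * dy R (ray v)).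

Lemma ray_lt4 v : (ray v < 4)%N.
Proof. by case: (polarP v) => *; lia. Qed.

Lemma rad_gt0 v : (0 < rad v)%N.
Proof. by case: (polarP v) => *; lia. Qed.

Lemma gauge_pos v : gauge (web_pos v) = (rad v)%:R.
Proof. exact: gauge_ray (ray_lt4 v) (ler0n _ _). Qed.

Lemma web_pos_ray v i s : (i < 4)%N -> 0 < s ->
  web_pos v = (s * dx R i, s * dy R i) -> (rad v)%:R = s /\ ray v = i.
Proof.
move=> hi s0 E; have Er : (rad v)%:R = s.
  by rewrite -gauge_pos E gauge_ray // ltW.
case: E => E1 E2; split => //.
by apply: (ray_disjoint (ray_lt4 v) hi _ s0 E1 E2); rewrite Er.
Qed.

Lemma web_pos_inj : injective web_pos.
Proof.
move=> u v /(web_pos_ray (ray_lt4 v)) [|E1 E2]; first by rewrite ltr0n rad_gt0.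
by apply: (polar_inj (k := k)) => //; apply/eqP; rewrite -(eqr_nat R) E1.
Qed.

(** In these coordinates the gauge is [s] on a radial edge and [rad u] on a ring edge, which makes
    edges of both kinds comparable. *)
Variant edge_point_spec u v p : Prop :=
  | RadialPoint s of radial (polar u) (polar v) &
      (rad u)%:R <= s & s <= (rad u).+1%:R & p = (s * dx R (ray u), s * dy R (ray u))
  | RingPoint s t of ring (polar u) (polar v) & 0 <= s & 0 <= t &
      s + t = (rad u)%:R & p = mix (ray u) s (ray v) t.

Lemma edge_pointP u v p : edge (polar u) (polar v) ->
  segment (web_pos u) (web_pos v) p -> edge_point_spec u v p.
Proof.
move=> /orP[] uv [t /andP[t0 t1] ->].
  apply: (RadialPoint (s := (rad u)%:R + t)) => //.
  - by rewrite lerDl.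
  - by rewrite -natr1 lerD2l.
  - case/and3P: uv => /= /eqP uv _ /eqP ruv.
    by rewrite /line /web_pos /= -uv ruv -natr1; congr pair; lra.
have r0 : 0 <= (rad u)%:R :> R by [].
apply: (RingPoint (s := (1 - t) * (rad u)%:R) (t := t * (rad u)%:R)) => //.
- by rewrite mulr_ge0 ?subr_ge0.
- by rewrite mulr_ge0.
- lra.
- by case/andP: uv => /= /eqP uv _; rewrite /line /web_pos /mix /= -uv !mulrA.
Qed.

Lemma gauge_ring_point u v s t : ring (polar u) (polar v) -> 0 <= s -> 0 <= t ->
  s + t = (rad u)%:R -> gauge (mix (ray u) s (ray v) t) = (rad u)%:R.
Proof. by move=> /andP[_ sd] s0 t0 <-; exact: gauge_side sd s0 t0. Qed.

Lemma web_pos_radial u v s : radial (polar u) (polar v) ->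
  (s == (rad u)%:R) || (s == (rad u).+1%:R) ->
  range web_pos (s * dx R (ray u), s * dy R (ray u)).
Proof.
move=> /and3P[/= /eqP e1 _ /eqP e2] /orP[] /eqP ->; first by exists u.
by exists v => //; rewrite /web_pos e2 e1.
Qed.

Lemma nat_in_unit n m s : n%:R <= s -> s <= n.+1%:R -> s = m%:R :> R ->
  (s == n%:R) || (s == n.+1%:R).
Proof. by move=> h1 h2 e; move: h1 h2; rewrite e !ler_nat !eqr_nat; lia. Qed.

(** The sides of one ring span cones with disjoint interiors; linear arithmetic refutes every pair
    of distinct sides. *)
Lemma side_cross r i j i' j' s t s' t' : side r i j -> side r i' j' ->
  0 < s -> 0 < t -> 0 < s' -> 0 < t' -> s + t = s' + t' ->
  mix i s j t = mix i' s' j' t' -> i = i' /\ j = j'.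
Proof.
rewrite /side; case: ifP => _; [move=> /andP[_ +] /andP[_ +]|];
  rewrite !inE; do !case/orP; move=> /eqP[-> ->];
  do !case/orP; move=> /eqP[-> ->]; rewrite /mix /dx /dy /= => ? ? ? ? ? [? ?];
  by [|exfalso; lra].
Qed.

(** Compare gauges. Radial edges that meet either start at the same radius, hence coincide, or touch
    at a common integer radius. A ring edge has integer gauge, which a radial edge attains only at
    its ends. Ring edges that meet have equal radius, and [side_cross] applies away from their
    ends. *)
Lemma edge_cross u v u' v' p :
  edge (polar u) (polar v) -> edge (polar u') (polar v') ->
  segment (web_pos u) (web_pos v) p -> segment (web_pos u') (web_pos v') p ->
  u = u' /\ v = v' \/ range web_pos p.
Proof.
move=> e e' /(edge_pointP e) E /(edge_pointP e') E'.
wlog : u v u' v' e e' E E' / radial (polar u) (polar v) \/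
    ring (polar u) (polar v) /\ ring (polar u') (polar v').
  move=> W; have := W u v u' v' e e' E E'; have := W u' v' u v e' e E' E.
  move: e e'; rewrite /edge => /orP[|] h /orP[|] h' W1 W2.
  - by apply: W2; left.
  - by apply: W2; left.
  - by case: W1 => [|[-> ->]|]; [left|left|right].
  - by apply: W2; right.
move=> _.
case: E => [s h s1 s2 Ep|s t h s0 t0 st Ep];
  case: E' => [s' h' s1' s2' Ep'|s' t' h' s0' t0' st' Ep'].
- have rs : gauge p = s.
    by rewrite Ep gauge_ray ?ray_lt4 // (le_trans _ s1).
  have rs' : gauge p = s'.
    by rewrite Ep' gauge_ray ?ray_lt4 // (le_trans _ s1').
  rewrite {}rs in rs'; subst s'.
  have s_gt0 : 0 < s by rewrite (lt_le_trans _ s1) // ltr0n rad_gt0.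
  have [er|nr] := eqVneq (rad u) (rad u').
    left; move: Ep'; rewrite Ep => -[E1 E2].
    have eu := ray_disjoint (ray_lt4 u) (ray_lt4 u') s_gt0 s_gt0 E1 E2.
    case/and3P: h => /= /eqP a1 _ /eqP a2; case/and3P: h' => /= /eqP b1 _ /eqP b2.
    by split; apply: (polar_inj (k := k)) => //; rewrite -?a1 -?b1 ?a2 ?b2 ?er.
  right; rewrite Ep; apply: web_pos_radial h _.
  have h1 : (rad u)%:R <= (rad u').+1%:R :> R by apply: le_trans s2'.
  have h2 : (rad u')%:R <= (rad u).+1%:R :> R by apply: le_trans s2.
  rewrite !ler_nat in h1 h2.
  have [lt|ge] := ltnP (rad u) (rad u').
    have e1 : rad u' = (rad u).+1 by lia.
    by apply/orP; right; rewrite eq_le s2 -e1.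
  have e1 : rad u = (rad u').+1 by lia.
  by apply/orP; left; rewrite eq_le s1 e1 s2'.
- right; rewrite Ep; apply: (web_pos_radial h); apply: (nat_in_unit (m := rad u')) => //.
  rewrite -(gauge_ring_point h' s0' t0' st') -Ep' Ep gauge_ray ?ray_lt4 //.
  exact: le_trans s1.
- right; rewrite Ep'; apply: (web_pos_radial h').
  apply: (nat_in_unit (m := rad u)) => //.
  rewrite -(gauge_ring_point h s0 t0 st) -Ep Ep' gauge_ray ?ray_lt4 //.
  exact: le_trans s1'.
- have er : (rad u)%:R = (rad u')%:R :> R.
    by rewrite -(gauge_ring_point h s0 t0 st) -Ep Ep' gauge_ring_point.
  case/andP: (h) => /= /eqP ruv hs; case/andP: (h') => /= /eqP ruv' hs'.
  (* A point of a side with a vanishing coordinate is an end of that side, so both coordinates may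
     be taken positive. *)
  have end_point (a b : web_vertex k) (x y : R) : ring (polar a) (polar b) -> 0 <= x -> 0 <= y ->
      x + y = (rad a)%:R -> p = mix (ray a) x (ray b) y ->
      range web_pos p \/ 0 < x /\ 0 < y.
    move=> /andP[/= /eqP rab _] x0 y0 xy ->.
    have [xz|nx] := eqVneq x 0.
      left; exists b => //; rewrite /web_pos /mix -rab -xy xz !mul0r !add0r //.
    have [yz|ny] := eqVneq y 0.
      left; exists a => //; rewrite /web_pos /mix -xy yz !mul0r !addr0 //.
    by right; rewrite !lt_neqAle x0 y0 eq_sym nx eq_sym ny.
  have [|[s0_ t0_]] := end_point _ _ _ _ h s0 t0 st Ep; first by right.
  have [|[s0_' t0_']] := end_point _ _ _ _ h' s0' t0' st' Ep'; first by right.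
  left; have eru : rad u = rad u' by apply/eqP; rewrite -(eqr_nat R) er.
  rewrite -eru in hs'.
  have [] := side_cross hs hs' s0_ t0_ s0_' t0_' _ (etrans (esym Ep) Ep').
    by rewrite st st'.
  by move=> i1 i2; split; apply: (polar_inj (k := k)) => //; rewrite -?ruv -?ruv'.
Qed.

Lemma edge_vertex u v z : edge (polar u) (polar v) ->
  segment (web_pos u) (web_pos v) (web_pos z) -> z = u \/ z = v.
Proof.
move=> e /(edge_pointP e) [s h s1 s2 Ep|s t h s0 t0 st Ep].
  have s_gt0 : 0 < s by rewrite (lt_le_trans _ s1) // ltr0n rad_gt0.
  have [rz iz] := web_pos_ray (ray_lt4 u) s_gt0 Ep.
  case/and3P: h => /= /eqP a1 _ /eqP a2.
  have := nat_in_unit s1 s2 (esym rz); rewrite -rz !eqr_nat => /orP[] /eqP hr.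
    by left; apply: (polar_inj (k := k)).
  by right; apply: (polar_inj (k := k)); rewrite ?iz ?a2.
have rz : rad z = rad u.
  by apply/eqP; rewrite -(eqr_nat R) -gauge_pos Ep gauge_ring_point.
have r0 : 0 < (rad u)%:R :> R by rewrite ltr0n rad_gt0.
case/andP: (h) => /= /eqP ruv hs.
suff [|] : ray z = ray u \/ ray z = ray v.
- by left; apply: (polar_inj (k := k)).
- by right; apply: (polar_inj (k := k)); rewrite // rz.
move: Ep; rewrite /web_pos rz => -[].
(* The side from ray 2 to ray 0 does cross ray 3, but it occurs only below radius 5, where ray 3 has
   no vertex. *)
have z3 : (ray u == 2) && (ray v == 0) -> (ray z < 3)%N.
  case/andP => /eqP u2 /eqP v0; move: hs; rewrite u2 v0 /side; case: ifP => // r5 _.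
  by case: (polarP z) rz => *; lia.
have {}hs : (ray u, ray v) \in [:: (0, 1); (1, 2); (2, 3); (3, 0); (2, 0)]%N.
  move: hs; rewrite /side; case: ifP => _; first move=> /andP[_]; rewrite !inE;
    by do !case/orP; move=> ->; rewrite ?orbT.
rewrite -st in r0 *; move: (ray_lt4 z) z3 hs; rewrite !inE => z4 + hs.
case: (ray z) z4 => [|[|[|[|]]]] // _ z3; move: hs z3; do !case/orP;
  move=> /eqP[-> ->] /= z3; rewrite /dx /dy /= => E1 E2;
  by [left | right | exfalso; lra | have := z3 isT].
Qed.

Lemma web_adj_seg u v p : web_adj u v -> segment (web_pos u) (web_pos v) p ->
  exists u' v', [/\ edge (polar u') (polar v'),
    segment (web_pos u') (web_pos v') p & (u', v') = (u, v) \/ (u', v') = (v, u)].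
Proof.
move=> /orP[] e s; [exists u, v | exists v, u]; split => //; [by left| |by right].
by rewrite segmentC.
Qed.

Definition web_arc u v := segment (web_pos u) (web_pos v).

Lemma web_arc_sym u v : web_adj u v -> web_arc u v = web_arc v u.
Proof. by move=> _; exact: segmentC. Qed.

Lemma web_arcP u v : web_adj u v -> is_arc (web_arc u v) (web_pos u) (web_pos v).
Proof.
move=> uv; apply: segment_arc; apply: contraTneq uv => /web_pos_inj ->.
by rewrite web_adj_irr.
Qed.

Lemma web_arc_vertex u v z : web_adj u v -> web_arc u v (web_pos z) ->
  z = u \/ z = v.
Proof.
move=> uv /(web_adj_seg uv) [u' [v' [e s]]].
by case=> -[<- <-]; case: (edge_vertex e s) => ->; auto.
Qed.

Lemma web_arc_cross x y x' y' : web_adj x y -> web_adj x' y' ->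
  ~ (x = x' /\ y = y') -> ~ (x = y' /\ y = x') ->
  web_arc x y `&` web_arc x' y' `<=` range web_pos.
Proof.
move=> a a' n1 n2 p [/(web_adj_seg a)[u [v [e s E]]]].
move=> /(web_adj_seg a')[u' [v' [e' s' E']]].
have [[uu vv]|//] := edge_cross e e' s s'.
by exfalso; subst u' v'; case: E E' => -[? ?] [] [? ?]; subst; auto.
Qed.

Definition web : plane_graph R := PlaneGraph (@web_adj_sym k) (@web_adj_irr k)
  web_pos_inj web_arc_sym web_arcP web_arc_vertex web_arc_cross.

End Drawing.

(** * Sectors *)

(** As [K] adds only points of [D] to [U], the set [U] is both open and closed relative to the
    complement of [D]; being connected, it is a whole component. *)
Lemma clopen_component (T : topologicalType) (D U K : set T) p :
  U p -> connected U -> open U -> closed K -> U `<=` K -> K `\` U `<=` D ->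
  U `<=` ~` D -> connected_component (~` D) p = U.
Proof.
move=> Up cU oU cK UK KD UD; rewrite eqEsubset; split; last first.
  exact: connected_component_max.
set C := connected_component _ _.
have CD : C `<=` ~` D by exact: connected_component_sub.
suff <- : C `&` U = C by apply: subIsetr.
apply: (@component_connected _ (~` D) p).
- by exists p; split => //; apply: connected_component_refl; exact: UD.
- by exists U.
- exists K => //; rewrite eqEsubset; split=> x [Cx hx]; split=> //.
    exact: UK.
  by apply: contrapT => nUx; exact: (CD x Cx (KD x (conj hx nUx))).
Qed.

Section Sectors.
Variable R : realType.
Implicit Types (p q : R * R) (s t : R).

Lemma fst_continuous : continuous (fun p => p.1).
Proof. by move=> p; exact: cvg_fst. Qed.

Lemma snd_continuous : continuous (fun p => p.2).
Proof. by move=> p; exact: cvg_snd. Qed.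

Lemma gauge_continuous : continuous (@gauge R).
Proof.
move=> p; have c1 := @fst_continuous p; have c2 := @snd_continuous p.
apply: (@continuous_max R _ (fun p => p.1 + p.2) _ p).
  exact: cvgD.
apply: (@continuous_max R _ (fun p => p.2 - 2 * p.1) (fun p => p.1 - 2 * p.2) p).
- by apply: cvgB => //; apply: cvgMr.
- by apply: cvgB => //; apply: cvgMr.
Qed.

Definition next_ray (i : nat) : nat := nth 0%N [:: 1; 2; 0]%N i.

(* Coordinates in the basis formed by the directions of the rays [i] and [next_ray i]. *)
Definition coord1 i p := nth 0 [:: p.1; p.2 - p.1; - p.2] i.
Definition coord2 i p := nth 0 [:: p.2; - p.1; p.1 - p.2] i.

(** On this cone the sum of the coordinates is the gauge, so the bounds 1 and 4 stand for the inner
    and the outer triangle. *)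
Definition sector i : set (R * R) := [set p | [/\ 0 < coord1 i p, 0 < coord2 i p,
  1 < coord1 i p + coord2 i p & coord1 i p + coord2 i p < 4]].
Definition sector_closure i : set (R * R) :=
  [set p | [/\ 0 <= coord1 i p, 0 <= coord2 i p,
  1 <= coord1 i p + coord2 i p & coord1 i p + coord2 i p <= 4]].

Lemma coord1_continuous i : continuous (coord1 i).
Proof.
move=> p; have c1 := @fst_continuous p; have c2 := @snd_continuous p.
rewrite /coord1; case: i => [|[|[|i]]] //=.
- exact: cvgB.
- exact: cvgN.
- by rewrite nth_nil; exact: cvg_cst.
Qed.

Lemma coord2_continuous i : continuous (coord2 i).
Proof.
move=> p; have c1 := @fst_continuous p; have c2 := @snd_continuous p.
rewrite /coord2; case: i => [|[|[|i]]] //=.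
- exact: cvgN.
- exact: cvgB.
- by rewrite nth_nil; exact: cvg_cst.
Qed.

Lemma coordD_continuous i : continuous (fun p => coord1 i p + coord2 i p).
Proof. by move=> p; apply: cvgD; [exact: coord1_continuous|exact: coord2_continuous]. Qed.

Lemma sector_open i : open (sector i).
Proof.
have og (f : R * R -> R) c : continuous f -> open [set p | c < f p].
  by move=> cf; apply: (@open_comp _ _ f [set x | c < x]) => [p _|]; [exact: cf|exact: open_gt].
have ol (f : R * R -> R) c : continuous f -> open [set p | f p < c].
  by move=> cf; apply: (@open_comp _ _ f [set x | x < c]) => [p _|]; [exact: cf|exact: open_lt].
rewrite (_ : sector i = [set p | 0 < coord1 i p] `&` [set p | 0 < coord2 i p] `&`
  ([set p | 1 < coord1 i p + coord2 i p] `&` [set p | coord1 i p + coord2 i p < 4])).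
  apply: openI; apply: openI; [apply: og|apply: og|apply: og|apply: ol].
  - exact: coord1_continuous.
  - exact: coord2_continuous.
  - exact: coordD_continuous.
  - exact: coordD_continuous.
by rewrite eqEsubset; split=> p /=; [case | move=> [[? ?] [? ?]]].
Qed.

Lemma sector_closure_closed i : closed (sector_closure i).
Proof.
have cg (f : R * R -> R) c : continuous f -> closed [set p | c <= f p].
  by move=> cf; apply: (@closed_comp _ _ f [set x | c <= x]) => [p _|]; [exact: cf|exact: closed_ge].
have cl (f : R * R -> R) c : continuous f -> closed [set p | f p <= c].
  by move=> cf; apply: (@closed_comp _ _ f [set x | x <= c]) => [p _|]; [exact: cf|exact: closed_le].
rewrite (_ : sector_closure i =
  [set p | 0 <= coord1 i p] `&` [set p | 0 <= coord2 i p] `&`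
  ([set p | 1 <= coord1 i p + coord2 i p] `&` [set p | coord1 i p + coord2 i p <= 4])).
  apply: closedI; apply: closedI; [apply: cg|apply: cg|apply: cg|apply: cl].
  - exact: coord1_continuous.
  - exact: coord2_continuous.
  - exact: coordD_continuous.
  - exact: coordD_continuous.
by rewrite eqEsubset; split=> p /=; [case | move=> [[? ?] [? ?]]].
Qed.

Lemma sector_sub i : sector i `<=` sector_closure i.
Proof. by move=> p [? ? ? ?]; split; exact: ltW. Qed.

Lemma coord_mix i s t : (i < 3)%N ->
  coord1 i (mix i s (next_ray i) t) = s /\ coord2 i (mix i s (next_ray i) t) = t.
Proof.
by case: i => [|[|[|]]] // _; rewrite /coord1 /coord2 /mix /dx /dy /=; split; lra.
Qed.

Lemma mix_coord i p : (i < 3)%N -> p = mix i (coord1 i p) (next_ray i) (coord2 i p).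
Proof.
case: p => x y.
by case: i => [|[|[|]]] // _; rewrite /coord1 /coord2 /mix /dx /dy /=; congr pair; lra.
Qed.

Lemma coord_line i p q t :
  coord1 i (line p q t) = (1 - t) * coord1 i p + t * coord1 i q /\
  coord2 i (line p q t) = (1 - t) * coord2 i p + t * coord2 i q.
Proof.
by case: i => [|[|[|i]]]; rewrite /coord1 /coord2 /line /= ?nth_nil; split; lra.
Qed.

Definition center i : R * R := mix i 1 (next_ray i) 1.

(** All constraints are linear in the coordinates and strict at the center, so any positive move
    towards it makes them strict. This gives both the connectedness and the closure of the
    sector. *)
Lemma sector_star i p t : (i < 3)%N -> sector_closure i p -> 0 < t <= 1 ->
  sector i (line p (center i) t).
Proof.
move=> hi [a0 b0 ab1 ab4] /andP[t0 t1].
have [e1 e2] := coord_line i p (center i) t.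
have [c1 c2] := coord_mix 1 1 hi; rewrite c1 c2 in e1 e2.
rewrite /sector /= e1 e2.
have u0 : 0 <= 1 - t by lra.
have := mulr_ge0 u0 a0; have := mulr_ge0 u0 b0.
have : 0 <= (1 - t) * (coord1 i p + coord2 i p - 1) by apply: mulr_ge0 => //; lra.
have : 0 <= (1 - t) * (4 - (coord1 i p + coord2 i p)) by apply: mulr_ge0 => //; lra.
by split; lra.
Qed.

Lemma center_in i : (i < 3)%N -> sector i (center i).
Proof. by move=> hi; rewrite /sector /=; have [-> ->] := coord_mix 1 1 hi; split; lra. Qed.

Lemma sector_connected i : (i < 3)%N -> connected (sector i).
Proof.
move=> hi; rewrite (_ : sector i = \bigcup_(p in sector i) segment p (center i)).
  apply: bigcup_connected => [|p _]; last exact: connected_segment.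
  by exists (center i) => p _; exists 1; rewrite ?line1 // ler01 lexx.
rewrite eqEsubset; split=> [p sp|q [p sp [t /andP[t0 t1] ->]]].
  by exists p => //; exists 0; rewrite ?line0 // ler01 lexx.
have [->|nt] := eqVneq t 0; first by rewrite line0.
by apply: sector_star => //; [exact: sector_sub|rewrite lt_neqAle eq_sym nt t0].
Qed.

Lemma closure_sector i : (i < 3)%N -> closure (sector i) = sector_closure i.
Proof.
move=> hi; rewrite eqEsubset; split.
  have /closure_id -> := @sector_closure_closed i.
  exact: closureS (@sector_sub i).
move=> p sp B Bp.
have : nbhs (0 : R) (line p (center i) @^-1` B).
  by apply: line_continuous; rewrite line0.
move=> /nbhs_ballP[e /= e0 he].
(* Half of [e] keeps the parameter inside the ball, and the bound 1 keeps the point on the segment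
   to the center. *)
pose t := Num.min (e / 2) 1.
have t0 : 0 < t by rewrite lt_min ltr01 divr_gt0.
have t1 : t <= 1 by rewrite ge_min lexx orbT.
exists (line p (center i) t); split; first by apply: sector_star => //; rewrite t0.
apply: he; rewrite /ball /= sub0r normrN gtr0_norm //.
by rewrite gt_min; apply/orP; left; lra.
Qed.

Lemma gauge_sector i p : (i < 3)%N -> 0 <= coord1 i p -> 0 <= coord2 i p ->
  gauge p = coord1 i p + coord2 i p.
Proof.
(* Radius 1 selects the triangle, whose sides are exactly the pairs of [i] and [next_ray i]. *)
move=> hi h1 h2; rewrite {1}(mix_coord p hi); apply: (@gauge_side R 1) => //.
by case: i hi {h1 h2} => [|[|[|]]].
Qed.

Lemma ray_notin_sector i j s : (i < 3)%N -> (j < 3)%N -> 0 <= s ->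
  ~ sector i (s * dx R j, s * dy R j).
Proof.
rewrite /sector /coord1 /coord2 /dx /dy.
by case: i => [|[|[|]]] // _; case: j => [|[|[|]]] //= _ s0 [] *; lra.
Qed.

Lemma exists_sector p : exists2 i, (i < 3)%N & 0 <= coord1 i p /\ 0 <= coord2 i p.
Proof.
case: p => x y; rewrite /coord1 /coord2.
case: (lerP 0 x) => hx; case: (lerP 0 y) => hy; case: (lerP x y) => hxy;
  (do [by exists 0%N => //=; split; lra | by exists 1%N => //=; split; lra |
       by exists 2%N => //=; split; lra]).
Qed.
End Sectors.

(** * Faces *)

Section Faces.
Variables (R : realType) (k : nat).
Local Notation web := (web R k).
Implicit Types (u v z : web_vertex k) (p : R * R) (s t : R).

(** Keeps ring edges out of the sectors, where the gauge lies strictly between 1 and 4. *)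
Lemma ring_rad u v : ring (polar u) (polar v) -> rad u = 1%N \/ (3 < rad u)%N.
Proof.
move=> /andP[_]; rewrite /side /=; case: ifP => h; last by right; lia.
by move=> /andP[/orP[] /eqP -> _]; [left|right].
Qed.

(** The gauge excludes radii above 4. Up to radius 4 only rays 0, 1, 2 carry vertices, and the third
    of them has a negative coordinate in the cone of the other two. *)
Lemma incident_sector i v : (i < 3)%N -> incident (v : vertex web) (sector i) <->
  ((rad v < 5)%N /\ (ray v = i \/ ray v = next_ray i)).
Proof.
move=> hi; rewrite /incident closure_sector //.
have Ev : pos (v : vertex web) = ((rad v)%:R * dx R (ray v), (rad v)%:R * dy R (ray v)) by [].
have r0 : 1 <= (rad v)%:R :> R by rewrite ler1n rad_gt0.
split.
  move=> sv; have gv : gauge (pos (v : vertex web)) <= 4.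
    by case: sv => a0 b0 _ ab; rewrite (gauge_sector hi a0 b0).
  have r5 : (rad v < 5)%N by move: gv; rewrite gauge_pos ler_nat.
  split=> //; have r3 : (ray v < 3)%N by case: (polarP v) r5 => *; lia.
  case: sv => a0 b0 _ _; move: a0 b0; rewrite {}Ev /coord1 /coord2 /dx /dy.
  case: i hi => [|[|[|]]] // _; case: (ray v) r3 => [|[|[|]]] // _ /= a0 b0;
    by [left|right|exfalso; lra].
case=> r5 hv; have r4 : (rad v)%:R <= 4 :> R by rewrite ler_nat.
rewrite {}Ev /sector_closure /= /coord1 /coord2 /dx /dy.
by case: i hi hv => [|[|[|]]] // _ [] -> /=; split; lra.
Qed.

Hypothesis hk : (3 <= k)%N.

Lemma drawing_edge i r j q p : polar_spec k i r -> polar_spec k j q ->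
  edge (i, r) (j, q) ->
  segment (r%:R * dx R i, r%:R * dy R i) (q%:R * dx R j, q%:R * dy R j) p ->
  drawing web p.
Proof.
move=> /(polar_surj hk)[u [<- <-]] /(polar_surj hk)[v [<- <-]] e sp.
by right; exists u, v; split => //; apply/orP; left.
Qed.

Lemma drawing_side i r j s t : side r i j -> (0 < r <= k.+1)%N ->
  0 <= s -> 0 <= t -> s + t = r%:R -> drawing web (mix i s j t).
Proof.
move=> ij /andP[r1 rk] s0 t0 st.
have r0 : 0 < r%:R :> R by rewrite ltr0n.
have [iP jP] : polar_spec k i r /\ polar_spec k j r.
  move: (ij); rewrite /side; case: ifP => r5.
    move=> /andP[_]; rewrite !inE; do !case/orP; move=> /eqP[-> ->];
      by split; apply: PolarPath; rewrite ?r1.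
  rewrite !inE; do !case/orP; move=> /eqP[-> ->];
    by split; apply: PolarRing => //; lia.
apply: (drawing_edge iP jP).
  by apply/orP; right; rewrite /ring /= eqxx ij.
(* The position along the side is the share of the second coordinate in the total [r]. *)
exists (t / r%:R).
  apply/andP; split; first by apply: divr_ge0.
  by rewrite ler_pdivrMr // mul1r -st lerDr.
have rr : t / r%:R * r%:R = t by rewrite divfK ?gt_eqF.
have sr : (1 - t / r%:R) * r%:R = s by rewrite mulrBl mul1r rr -st addrK.
by rewrite /line /mix /= !mulrA rr sr.
Qed.

Lemma drawing_ray i s : (i < 3)%N -> 1 <= s -> s <= 4 ->
  drawing web (s * dx R i, s * dy R i).
Proof.
move=> hi s1 s4.
suff h r : (0 < r < 4)%N -> r%:R <= s -> s <= r%:R + 1 ->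
    drawing web (s * dx R i, s * dy R i).
  have [s2|s2] := lerP s 2; first by apply: (h 1%N) => //; lra.
  have [s3|s3] := lerP s 3; first by apply: (h 2%N) => //; lra.
  by apply: (h 3%N) => //; lra.
move=> hr h1 h2; apply: (@drawing_edge i r i r.+1).
- by apply: PolarPath => //; lia.
- by apply: PolarPath => //; lia.
- by rewrite /edge /radial /= eqxx hi eqxx.
- exists (s - r%:R); first by apply/andP; split; lra.
  by rewrite /line -natr1 /=; congr pair; lra.
Qed.

(** The ring of radius [r] is drawn along the entire triangle [gauge = r]: its quadrilateral form
    has the same shape. Radii 2 and 3, which carry no ring, are excluded by the bound. *)
Lemma gauge_drawing r p : (4 <= r <= k.+1)%N -> gauge p = r%:R ->
  drawing web p.
Proof.
move=> hr gp; have [i hi [a0 b0]] := exists_sector p.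
rewrite (gauge_sector hi a0 b0) in gp; rewrite (mix_coord p hi).
have r0 : (0 < r <= k.+1)%N by lia.
have [r4|r4] := eqVneq r 4%N.
  rewrite r4 in gp; apply: (drawing_side (r := 4)) => //.
  by case: i hi {a0 b0 gp} => [|[|[|]]].
have r5 : (r < 5)%N = false by lia.
case: i hi a0 b0 gp => [|[|[|]]] // _ a0 b0 gp.
- by apply: (drawing_side (r := r)); rewrite // /side r5.
- by apply: (drawing_side (r := r)); rewrite // /side r5.
(* The side of a quadrilateral ring from ray 2 to ray 0 passes through ray 3. *)
move: (coord1 2 p) (coord2 2 p) a0 b0 gp => a b a0 b0 gp.
have [ab|ab] := lerP b a.
  have -> : mix 2 a (next_ray 2) b = mix 2 (a - b) 3 (2 * b).
    by rewrite /mix /dx /dy /=; congr pair; lra.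
  apply: (drawing_side (r := r)) => //; [by rewrite /side r5|lra|lra|lra].
have -> : mix 2 a (next_ray 2) b = mix 3 (2 * a) 0 (b - a).
  by rewrite /mix /dx /dy /=; congr pair; lra.
apply: (drawing_side (r := r)) => //; [by rewrite /side r5|lra|lra|lra].
Qed.

(** Each point of the drawing lies on one of the rays 0, 1, 2 or has gauge 1 or at least 4; a sector
    contains no such point. *)
Lemma sector_notin_drawing i : (i < 3)%N -> sector i `<=` ~` drawing web.
Proof.
move=> hi p sp; have gp : 1 < gauge p < 4.
  by case: sp => a0 b0 ab1 ab4; rewrite (gauge_sector hi (ltW a0) (ltW b0)) ab1.
have rayp j s : (j < 3)%N -> 0 <= s -> p = (s * dx R j, s * dy R j) -> False.
  by move=> hj s0 Ep; apply: (ray_notin_sector hi hj s0); rewrite -Ep.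
have radp (n : nat) : gauge p = n%:R -> n = 1%N \/ (3 < n)%N -> False.
  move=> e [n1|n4]; first by move: gp; rewrite e n1 ltxx.
  by move: gp; rewrite e => /andP[_]; rewrite ltr_nat; lia.
case=> [[v _ Ep]|[x [y [xy sp']]]].
  have : (ray v < 3)%N \/ (3 < rad v)%N by case: (polarP v) => *; [left|right; lia].
  case=> h; first exact: (rayp (ray v) (rad v)%:R h _ (esym Ep)).
  by apply: (radp (rad v)); [rewrite -Ep; exact: gauge_pos|right].
have [u [v [e s _]]] := web_adj_seg xy sp'.
case: (edge_pointP e s) => [t h t1 _ Ep|a b h a0 b0 ab Ep].
  apply: (rayp _ _ _ _ Ep); last exact: le_trans t1.
  by case/and3P: h.
by apply: (radp (rad u)); [rewrite Ep gauge_ring_point|exact: ring_rad h].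
Qed.

(** Some defining inequality is an equality there: a vanishing coordinate puts the point on a path,
    the sum 1 or 4 on a triangle. *)
Lemma sector_boundary i : (i < 3)%N ->
  sector_closure i `\` sector i `<=` drawing web.
Proof.
move=> hi p [[a0 b0 ab1 ab4] np].
have hi' : (next_ray i < 3)%N by case: i hi {a0 b0 ab1 ab4 np} => [|[|[|]]].
have Ep := mix_coord p hi.
have [az|an] := eqVneq (coord1 i p) 0.
  rewrite Ep az /mix !mul0r !add0r; apply: drawing_ray => //.
    by rewrite az add0r in ab1.
  by rewrite az add0r in ab4.
have [bz|bn] := eqVneq (coord2 i p) 0.
  rewrite Ep bz /mix !mul0r !addr0; apply: drawing_ray => //.
    by rewrite bz addr0 in ab1.
  by rewrite bz addr0 in ab4.
have [e1|n1] := eqVneq (coord1 i p + coord2 i p) 1.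
  rewrite Ep; apply: (@drawing_side _ 1) => //.
  by case: i hi {Ep a0 b0 ab1 ab4 np hi' an bn e1} => [|[|[|]]].
have [e4|n4] := eqVneq (coord1 i p + coord2 i p) 4.
  rewrite Ep; apply: (@drawing_side _ 4) => //.
  by case: i hi {Ep a0 b0 ab1 ab4 np hi' an bn e4 n1} => [|[|[|]]].
exfalso; apply: np; split; rewrite lt_neqAle.
- by rewrite eq_sym an.
- by rewrite eq_sym bn.
- by rewrite eq_sym n1.
- by rewrite n4.
Qed.

Lemma sector_face i : (i < 3)%N -> is_face web (sector i).
Proof.
move=> hi; exists (center R i).
  exact: (sector_notin_drawing hi (center_in R hi)).
apply/esym; apply: (clopen_component (K := sector_closure i)).
- exact: center_in.
- exact: sector_connected.
- exact: sector_open.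
- exact: sector_closure_closed.
- exact: sector_sub.
- exact: sector_boundary.
- exact: sector_notin_drawing.
Qed.

(* The level set [gauge = r] lies in the drawing, and the gauge maps a face to an interval. *)
Lemma incident_not_separated F (u v : vertex web) r : is_face web F ->
  (4 <= r <= k.+1)%N -> incident u F -> incident v F ->
  (rad (u : web_vertex k) < r)%N -> (r < rad (v : web_vertex k))%N -> False.
Proof.
move=> [p _ EF] hr iu iv ur rv.
have cF : connected F by rewrite EF; exact: component_connected.
have FD : F `<=` ~` drawing web by rewrite EF; exact: connected_component_sub.
have [a [Fa ar]] : F `&` (gauge (R := R) @^-1` [set x | x < r%:R]) !=set0.
  apply: iu; apply: open_nbhs_nbhs; split.
    by apply: open_comp => [x _|]; [exact: gauge_continuous|exact: open_lt].
  by rewrite /= gauge_pos ltr_nat.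
have [b [Fb rb]] : F `&` (gauge (R := R) @^-1` [set x | r%:R < x]) !=set0.
  apply: iv; apply: open_nbhs_nbhs; split.
    by apply: open_comp => [x _|]; [exact: gauge_continuous|exact: open_gt].
  by rewrite /= gauge_pos ltr_nat.
have /connected_intervalP gI : connected (gauge (R := R) @` F).
  apply: connected_continuous_connected => //.
  by apply: continuous_subspaceT => x; exact: gauge_continuous.
have [c Fc gc] : (gauge (R := R) @` F) r%:R.
  apply: (gI (gauge a) (gauge b)); [by exists a|by exists b|].
  by rewrite (ltW ar) (ltW rb).
exact: (FD c Fc (gauge_drawing hr gc)).
Qed.

End Faces.

(** * Colourings *)

Section Colors.
Variables (R : realType) (k : nat).
Hypothesis hk : (3 <= k)%N.
Local Notation web := (web R k).
Implicit Types (u v z : web_vertex k).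
Local Open Scope nat_scope.

Definition base (x : 'I_3 * 'I_4) : web_vertex k := (widen_ord hk x.1, x.2).

Lemma base_polar x : ray (base x) = x.1 /\ rad (base x) = x.2.+1.
Proof. by rewrite /ray /rad /= ltn_ord. Qed.

Lemma base_inj : injective base.
Proof. by move=> [b j] [b' j'] [/val_inj -> ->]. Qed.

Lemma base_surj v : rad v < 5 -> exists x, v = base x.
Proof.
case: v => b j; rewrite /rad /=; case: ifPn => hb hr; last lia.
by exists (Ordinal hb, j); rewrite /base /=; congr pair; exact: val_inj.
Qed.

(** * The lower bound of twelve colours *)

Section LowerBound.
Variable col : web_vertex k -> nat.
Hypothesis colP : facial_parity_coloring (G := web) col.

Definition path_count c b := \sum_(j < 4) (col (base (b, j)) == c).

Lemma sector_count c i : i < 3 ->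
  face_color_count (G := web) col (sector i) c =
  \sum_(b < 3 | (b == i :> nat) || (b == next_ray i :> nat)) path_count c b.
Proof.
move=> hi; rewrite /path_count pair_big_dep /=.
rewrite (eq_bigl (fun x : 'I_3 * 'I_4 =>
  (x.1 == i :> nat) || (x.1 == next_ray i :> nat))); last by move=> x; rewrite andbT.
rewrite -big_mkcondr /= sum1_card -(card_imset _ base_inj).
apply: eq_card => v; rewrite !inE; apply/andP/imsetP => [[/asboolP + /eqP cv]|].
  move=> /(incident_sector R v hi)[/base_surj[x vx] rx]; exists x => //.
  have [rb _] := base_polar x; rewrite vx rb in rx.
  rewrite unfold_in /= -surjective_pairing -vx cv eqxx andbT.
  by case: rx => ->; rewrite eqxx ?orbT.
case=> x; rewrite unfold_in /= -surjective_pairing => /andP[xi cx] ->.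
have [r1 r2] := base_polar x; split=> //; apply/asboolP.
apply/(incident_sector R _ hi); rewrite r1 r2; split; first by rewrite ltnS ltn_ord.
by case/orP: xi => /eqP; [left|right].
Qed.

Lemma path_count_le2 c b : path_count c b <= 2.
Proof.
have colN (j j' : 'I_4) : j' = j.+1 :> nat -> col (base (b, j)) == c ->
    col (base (b, j')) == c -> False.
  move=> jj /eqP e /eqP e'; have := colP.1 (base (b, j)) (base (b, j')).
  rewrite e e'; apply => //; apply/orP; left; apply/orP; left.
  have [r1 r2] := base_polar (b, j); have [r3 r4] := base_polar (b, j').
  by rewrite /radial /polar /= r1 r2 r3 r4 /= jj !eqxx ltn_ord.
(* Of the sixteen patterns of occurrences on four vertices, those without two consecutive ones
   contain at most two. *)
rewrite /path_count !big_ord_recl big_ord0 /=.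
move: (colN ord0 (lift ord0 ord0) erefl).
move: (colN (lift ord0 ord0) (lift ord0 (lift ord0 ord0)) erefl).
move: (colN (lift ord0 (lift ord0 ord0)) (lift ord0 (lift ord0 (lift ord0 ord0))) erefl).
by do 4!case: (_ == c) => //=; do ?[by move=> /(_ isT isT) | move=> _].
Qed.

Lemma color_class_le1 c : #|[pred x | col (base x) == c]| <= 1.
Proof.
have -> : #|[pred x | col (base x) == c]| = \sum_(b < 3) path_count c b.
  rewrite /path_count pair_big /= -sum1_card big_mkcond /=.
  by apply: eq_bigr => -[b j] _; rewrite inE; case: ifP.
have F i (hi : i < 3) := colP.2 (sector i) c (sector_face R hk hi).
have := F 0 isT; have := F 1 isT; have := F 2 isT.
rewrite !sector_count // ![\sum_(b < 3 | _) _]big_mkcond !big_ord_recl !big_ord0 /=.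
move: (path_count_le2 c ord0) (path_count_le2 c (lift ord0 ord0)).
move: (path_count_le2 c (lift ord0 (lift ord0 ord0))).
move: (path_count c ord0) (path_count c (lift ord0 ord0)).
move: (path_count c (lift ord0 (lift ord0 ord0))) => n2 n0 n1.
(* Two nonzero counts would make all three pairwise sums odd, although these add up to an even
   number. A single nonzero count is odd and at most 2, so it is 1. *)
by move=> *; lia.
Qed.

Lemma num_colors_ge12 : 12 <= num_colors (G := web) col.
Proof.
have inj : injective (col \o base).
  move=> x y e; have /card_le1_eqP h := color_class_le1 (col (base x)).
  by apply: h; rewrite inE //= -[col (base y)]e.
have <- : size (codom (col \o base)) = 12 by rewrite size_codom card_prod !card_ord.
apply: uniq_leq_size; first by apply/injectiveP.
by move=> _ /codomP[x ->]; rewrite mem_undup; exact: codom_f.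
Qed.

End LowerBound.

(** The paths use each of the colours 0 to 11 once, so the outer triangle, at position 3, has 3, 7
    and 11. The two ring palettes avoid these and are disjoint. *)
Definition web_col v : nat :=
  if v.1 < 3 then 4 * v.1 + v.2
  else nth 0 (if odd v.1 then [:: 0; 1; 2; 4] else [:: 5; 6; 8; 9]) v.2.

Lemma web_col_lt12 v : web_col v < 12.
Proof.
case: v => b [j hj]; rewrite /web_col /=; case: ifP => hb; first lia.
by case: ifP => _; case: j hj => [|[|[|[|]]]].
Qed.

(** Vertices of equal colour are separated by the ring of radius [r], which no face crosses. *)
Lemma web_col_eq u v : web_col u = web_col v -> rad u <= rad v ->
  u = v \/ exists2 r, 4 <= r <= k.+1 & rad u < r < rad v.
Proof.
case: u v => b j [b' j']; rewrite /web_col /rad /=.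
have bk := ltn_ord b; have bk' := ltn_ord b'.
have jk := ltn_ord j; have jk' := ltn_ord j'.
case: (ltnP b 3) => hb; case: (ltnP b' 3) => hb' E hr.
- by left; congr pair; apply: val_inj => /=; lia.
(* A path vertex sharing its colour with a ring vertex is not on the outer triangle, so that
   triangle separates them. *)
- right; exists 4; first by [].
  suff : j <> 3 :> nat by lia.
  move=> j3; move: E; rewrite j3; case: odd; case: (val j') jk' => [|[|[|[|]]]] //= _; lia.
- lia.
have inj (s : seq nat) : s \in [:: [:: 0; 1; 2; 4]; [:: 5; 6; 8; 9]] ->
    nth 0 s j = nth 0 s j' -> j = j'.
  move=> hs e; apply: val_inj; apply/eqP; rewrite -(nth_uniq 0 _ _ (s := s)) ?e //.
  - by move: hs; rewrite !inE => /orP[] /eqP ->.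
  - by move: hs; rewrite !inE => /orP[] /eqP ->.
  - by move: hs; rewrite !inE => /orP[] /eqP ->.
have [eb|nb] := eqVneq b b'.
  left; congr pair => //; move: E; rewrite eb.
  by case: ifP => _; apply: inj; rewrite !inE eqxx ?orbT.
have {}nb : b != b' :> nat by [].
(* This is the radius of block [b.+1]. Consecutive rings have disjoint palettes, so [b'] lies beyond
   that block. *)
right; exists b.+3; last first.
  suff : b' != b.+1 :> nat by lia.
  apply/eqP => e; move: E; rewrite e /=; case: odd => /=;
  by case: (val j) jk => [|[|[|[|]]]] // _; case: (val j') jk' => [|[|[|[|]]]].
lia.
Qed.

(** A ring strictly between two vertices of equal colour rules out that they are adjacent or share a
    face. Hence a colour occurs at most once on each face. *)
Lemma web_col_facial : facial_parity_coloring (G := web) web_col.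
Proof.
have H u v : web_col u = web_col v -> u <> v ->
    exists2 r, 4 <= r <= k.+1 & (rad u < r < rad v) || (rad v < r < rad u).
  move=> e n; have [le|le] := leqP (rad u) (rad v).
    by have [//|[r h1 h2]] := web_col_eq e le; exists r; rewrite // h2.
  have [/esym//|[r h1 h2]] := web_col_eq (esym e) (ltnW le).
  by exists r; rewrite // h2 orbT.
split=> [x y xy e|F c Ff].
  have xny : x <> y by move=> xy'; move: xy; rewrite xy' adj_irr.
  have [r _] := H _ _ e xny.
  (* Adjacent vertices have radii differing by at most one, which leaves no integer strictly
     between. *)
  suff : (rad (x : web_vertex k) <= (rad (y : web_vertex k)).+1) &&
    (rad (y : web_vertex k) <= (rad (x : web_vertex k)).+1) by lia.
  have ed u v : edge (polar u) (polar v) ->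
      (rad u <= (rad v).+1) && (rad v <= (rad u).+1).
    move=> /orP[/and3P[_ _ /eqP /= ->]|/andP[/eqP /= -> _]]; lia.
  by case/orP: xy => /ed // ; rewrite andbC.
suff : face_color_count (G := web) web_col F c <= 1.
  by case: face_color_count => [|[|]] //; [left|right].
apply/card_le1_eqP => x y; rewrite !inE => /andP[/asboolP ix /eqP xc].
move=> /andP[/asboolP iy /eqP yc]; apply: contrapT => xy.
have [r hr] := H y x (etrans yc (esym xc)) xy.
by case/orP=> /andP[h1 h2];
  [apply: (incident_not_separated hk Ff hr iy ix)|apply: (incident_not_separated hk Ff hr ix iy)].
Qed.

Lemma num_colors_web_col : num_colors (G := web) web_col = 12.
Proof.
apply/eqP; rewrite eqn_leq (num_colors_ge12 web_col_facial) andbT.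
rewrite -[12](size_iota 0); apply: uniq_leq_size; first exact: undup_uniq.
move=> c; rewrite mem_undup => /codomP[v ->].
by rewrite mem_iota web_col_lt12.
Qed.

Lemma chi_fp_web : chi_fp web = 12.
Proof.
rewrite /chi_fp; case: ex_minnP => m /asboolP[col colP <-] min.
apply/eqP; rewrite eqn_leq (num_colors_ge12 colP) andbT; apply: min.
by apply/asboolP; exists web_col; [exact: web_col_facial|exact: num_colors_web_col].
Qed.

End Colors.

Theorem theorem2 (R : realType) (k : nat) (hk : (3 <= k)%N) :
  exists G : plane_graph R,
    [/\ two_edge_connected G, #|vertex G| = (4 * k)%N & chi_fp G = 12%N].
Proof.
exists (web R k); split; last exact: chi_fp_web.
  split; [|exact: web_connected|move=> u v _; exact: del_edge_connected].
  by rewrite card_web_vertex; lia.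
exact: card_web_vertex.
Qed.
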